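(* Let $F$ be a rational formal power series with coefficients in $\mathbb{C}^{q\times q}$ and with $F_\emptyset=I_q$, and let $\alpha=(N;A,B,C,I_q;\mathbb{C}^\gamma=\bigoplus_{k=1}^N\mathbb{C}^{\gamma_k},\mathbb{C}^q)$ be a minimal GR-realization of $F$. Then the following statements hold: (i) if $\Pi={\rm diag}(\Pi_1,\ldots,\Pi_N)$ is a supporting projection for $\alpha$, $F'$ is the transfer function of ${\rm pr}_{I_\gamma-\Pi}(\alpha)$ and $F''$ is the transfer function of ${\rm pr}_\Pi(\alpha)$, then $F=F'F''$ is a minimal factorization of $F$; (ii) if $F=F'F''$ is a minimal factorization of $F$ (with $F'_\emptyset=F''_\emptyset=I_q$), then there exists a uniquely defined supporting projection $\Pi={\rm diag}(\Pi_1,\ldots,\Pi_N)$ for the GR-node $\alpha$ such that $F'$ and $F''$ are the transfer functions of ${\rm pr}_{I_\gamma-\Pi}(\alpha)$ and ${\rm pr}_\Pi(\alpha)$, respectively.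
   Context: Formal power series. $\mathcal{F}_N$ is the free monoid on generators $g_1,\ldots,g_N$ with empty word $\emptyset$. A formal power series (FPS) in non-commuting indeterminates $z_1,\ldots,z_N$ is $f(z)=\sum_{w\in\mathcal{F}_N}f_wz^w$; products are by convolution over factorizations of words. A scalar FPS is rational if it is obtained from non-commutative polynomials by finitely many sums, products and inversions (of FPSs with non-zero constant term); a matrix FPS is rational if all its entries are. GR-nodes. A GR-node $\alpha=(N;A,B,C,D;\mathcal{X}=\bigoplus_{k=1}^N\mathcal{X}_k,\mathbb{C}^q)$, with finite-dimensional $\mathcal{X}_k$ (e.g. $\mathcal{X}_k=\mathbb{C}^{r_k}$), consists of linear operators $A:\mathcal{X}\to\mathcal{X}$, $B:\mathbb{C}^q\to\mathcal{X}$, $C:\mathcal{X}\to\mathbb{C}^q$, $D:\mathbb{C}^q\to\mathbb{C}^q$, with blocks $A_{kj},B_k,C_j$. Its transfer function is the rational FPS $T^{\rm nc}_\alpha(z)=D+C(I-\Delta(z)A)^{-1}\Delta(z)B$, $\Delta(z)={\rm diag}(z_1I_{\mathcal{X}_1},\ldots,z_NI_{\mathcal{X}_N})$; the coefficient at $w=g_{j_1}\cdots g_{j_n}$ is $C_{j_1}A_{j_1j_2}\cdots A_{j_{n-1}j_n}B_{j_n}$. $\alpha$ is a GR-realization of $F$ if $T_\alpha^{\rm nc}=F$; it is minimal if each $\dim\mathcal{X}_k$ is the smallest possible among all GR-realizations of $F$ (minimal dimensions are denoted $\gamma_k$, $\gamma=\sum_k\gamma_k$). Products. The product $\alpha'\alpha''$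 of GR-nodes $\alpha',\alpha''$ (data marked by $'$ and $''$) has $k$-th state space $\mathcal{X}'_k\oplus\mathcal{X}''_k$ and $$A_{kj}=\begin{pmatrix} A'_{kj} & B'_kC''_j \\ 0 & A''_{kj} \end{pmatrix},\quad B_k=\begin{pmatrix} B'_kD'' \\ B''_k \end{pmatrix},\quad C_j=\begin{pmatrix} C'_j & D'C''_j \end{pmatrix},\quad D=D'D''.$$ A factorization $F=F'F''$ into rational FPSs with $q\times q$ coefficients is minimal if whenever $\alpha'$ and $\alpha''$ are minimal GR-realizations of $F'$ and $F''$, respectively, $\alpha'\alpha''$ is a minimal GR-realization of $F$. Supporting projections. For $\alpha$ with $D=I_q$ let $A^\times=A-BC$ (in general $A^\times=A-BD^{-1}C$). $\Pi={\rm diag}(\Pi_1,\ldots,\Pi_N)$, where $\Pi_k$ is a (not necessarily orthogonal) projection on $\mathbb{C}^{\gamma_k}$, is a supporting projection for $\alpha$ if $A_{kj}\ker\Pi_j\subset\ker\Pi_k$ and $(A^\times)_{kj}\,{\rm ran}\,\Pi_j\subset{\rm ran}\,\Pi_k$ for all $k,j$. With respect to $\mathbb{C}^{\gamma_k}=\ker\Pi_k\dot{+}{\rm ran}\,\Pi_k$ write $A_{kj}=\begin{pmatrix} A^{(11)}_{kj} & A^{(12)}_{kj} \\ A^{(21)}_{kj} & A^{(22)}_{kj} \end{pmatrix}$, $B_k=\begin{pmatrix} B^{(1)}_k \\ B^{(2)}_k \end{pmatrix}$, $C_k=\begin{pmatrix} C^{(1)}_k & C^{(2)}_k \end{pmatrix}$.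 Then ${\rm pr}_{I_\gamma-\Pi}(\alpha)=(N;A^{(11)},B^{(1)},C^{(1)},I_q;\ker\Pi=\bigoplus_k\ker\Pi_k,\mathbb{C}^q)$ and ${\rm pr}_\Pi(\alpha)=(N;A^{(22)},B^{(2)},C^{(2)},I_q;{\rm ran}\,\Pi=\bigoplus_k{\rm ran}\,\Pi_k,\mathbb{C}^q)$. *)

(* Defs.v *)
From HB Require Import structures.
From mathcomp Require Export all_boot all_order all_algebra.
From mathcomp Require Export reals.
From mathcomp Require Export complex.

Set Implicit Arguments.
Unset Strict Implicit.
Unset Printing Implicit Defensive.

Import GRing.Theory.
Local Open Scope ring_scope.

(* Words in g_1, ..., g_N are sequences of letters in 'I_N; the series
   \sum_w f_w z^w is its coefficient function w |-> f_w. *)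
Definition fps (V : Type) (N : nat) := seq 'I_N -> V.

Section Series.
Variables (S : pzRingType) (N : nat).
Implicit Types f g : fps S N.

Definition fps_one : fps S N := fun w => if w is [::] then 1 else 0.

Definition fps_add f g : fps S N := fun w => f w + g w.

Definition fps_mul f g : fps S N :=
  fun w => \sum_(i < (size w).+1) f (take i w) * g (drop i w).

Definition fps_is_poly f :=
  exists s : seq (seq 'I_N), forall w, w \notin s -> f w = 0.

End Series.

Arguments fps_one {S N}.

Inductive fps_rational (K : fieldType) (N : nat) : fps K N -> Prop :=
| RatPoly f : fps_is_poly f -> fps_rational f
| RatAdd f g : fps_rational f -> fps_rational g -> fps_rational (fps_add f g)
| RatMul f g : fps_rational f -> fps_rational g -> fps_rational (fps_mul f g)
| RatInv f g : fps_rational f -> f [::] != 0 ->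
    fps_mul f g =1 fps_one -> fps_mul g f =1 fps_one -> fps_rational g.

Definition mx_fps_rational (K : fieldType) (q N : nat) (F : fps 'M[K]_q N) :=
  forall i j : 'I_q, fps_rational (fun w => F w i j).

(* Standard matrix of an operator on column vectors. *)
Definition mx_of_end (K : fieldType) (q : nat) (f : 'End('cV[K]_q)) : 'M[K]_q :=
  \matrix_(i, j) f (delta_mx j 0) i 0.

Lemma mx_of_endE (K : fieldType) (q : nat) (f : 'End('cV[K]_q)) (v : 'cV_q) :
  mx_of_end f *m v = f v.
Proof.
apply/matrixP=> i j; rewrite (ord1 j) mxE [in RHS](matrix_sum_delta v).
rewrite linear_sum summxE; apply: eq_bigr => k _.
by rewrite big_ord1 linearZ !mxE mulrC.
Qed.

(* GR-nodes with state space \bigoplus_k X k and input/output space K^q. *)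
Record GRnode (K : fieldType) (N q : nat) (X : 'I_N -> vectType K) := GRNode {
  gr_A : forall k j : 'I_N, 'Hom(X j, X k);
  gr_B : forall k : 'I_N, 'Hom('cV[K]_q, X k);
  gr_C : forall j : 'I_N, 'Hom(X j, 'cV[K]_q);
  gr_D : 'End('cV[K]_q)
}.

Section Nodes.
Variables (K : fieldType) (N q : nat).
Implicit Types X : 'I_N -> vectType K.

(* state_coef a [:: j_2; ...; j_n] j_1 =
     A_{j_1 j_2} A_{j_2 j_3} ... A_{j_{n-1} j_n} B_{j_n} *)
Fixpoint state_coef X (a : GRnode q X) (w : seq 'I_N) (j : 'I_N) :
    'Hom('cV[K]_q, X j) :=
  if w is k :: w' then (gr_A a j k \o state_coef a w' k)%VF else gr_B a j.

(* Coefficients of D + C (I - \Delta(z) A)^{-1} \Delta(z) B. *)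
Definition transfer X (a : GRnode q X) : fps 'M[K]_q N :=
  fun w => mx_of_end
    (if w is j :: w' then (gr_C a j \o state_coef a w' j)%VF else gr_D a).

Definition gr_realization X (a : GRnode q X) (F : fps 'M[K]_q N) :=
  transfer a =1 F.

Definition minimal_realization X (a : GRnode q X) (F : fps 'M[K]_q N) :=
  gr_realization a F /\
  forall (Y : 'I_N -> vectType K) (b : GRnode q Y), gr_realization b F ->
    forall k, (\dim {: X k} <= \dim {: Y k})%N.

Definition gr_mul X1 X2 (a1 : GRnode q X1) (a2 : GRnode q X2) :
    GRnode q (fun k => (X1 k * X2 k)%type : vectType K) :=
  @GRNode K N q (fun k => (X1 k * X2 k)%type : vectType K)
    (fun k j => linfun (fun x : X1 j * X2 j =>
       (gr_A a1 k j x.1 + gr_B a1 k (gr_C a2 j x.2), gr_A a2 k j x.2)))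
    (fun k => linfun (fun u : 'cV[K]_q =>
       (gr_B a1 k (gr_D a2 u), gr_B a2 k u)))
    (fun j => linfun (fun x : X1 j * X2 j =>
       gr_C a1 j x.1 + gr_D a1 (gr_C a2 j x.2)))
    (gr_D a1 \o gr_D a2)%VF.

(* The pair-valued functions above are linear, so linfun represents them. *)
Lemma gr_mul_AE X1 X2 (a1 : GRnode q X1) (a2 : GRnode q X2) k j x :
  gr_A (gr_mul a1 a2) k j x =
  (gr_A a1 k j x.1 + gr_B a1 k (gr_C a2 j x.2), gr_A a2 k j x.2).
Proof.
set f := fun x : X1 j * X2 j =>
  (gr_A a1 k j x.1 + gr_B a1 k (gr_C a2 j x.2), gr_A a2 k j x.2).
have lf : linear f.
  move=> c u v; rewrite /f /= !linearP /=; congr pair => /=.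
  by rewrite scalerDr addrACA.
by rewrite /= (lfunE (HB.pack f (GRing.isLinear.Build K _ _ _ f lf))).
Qed.

Lemma gr_mul_BE X1 X2 (a1 : GRnode q X1) (a2 : GRnode q X2) k u :
  gr_B (gr_mul a1 a2) k u = (gr_B a1 k (gr_D a2 u), gr_B a2 k u).
Proof.
set f := fun u : 'cV[K]_q => (gr_B a1 k (gr_D a2 u), gr_B a2 k u).
have lf : linear f by move=> c x y; rewrite /f !linearP.
by rewrite /= (lfunE (HB.pack f (GRing.isLinear.Build K _ _ _ f lf))).
Qed.

Lemma gr_mul_CE X1 X2 (a1 : GRnode q X1) (a2 : GRnode q X2) j x :
  gr_C (gr_mul a1 a2) j x = gr_C a1 j x.1 + gr_D a1 (gr_C a2 j x.2).
Proof.
set f := fun x : X1 j * X2 j => gr_C a1 j x.1 + gr_D a1 (gr_C a2 j x.2).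
have lf : linear f.
  by move=> c u v; rewrite /f /= !linearP /= scalerDr addrACA.
by rewrite /= (lfunE (HB.pack f (GRing.isLinear.Build K _ _ _ f lf))).
Qed.

Definition minimal_factorization (F F1 F2 : fps 'M[K]_q N) :=
  [/\ mx_fps_rational F1, mx_fps_rational F2, F =1 fps_mul F1 F2 &
    forall (X1 X2 : 'I_N -> vectType K) (a1 : GRnode q X1) (a2 : GRnode q X2),
      minimal_realization a1 F1 -> minimal_realization a2 F2 ->
      minimal_realization (gr_mul a1 a2) F].

(* (D^-1)%VF is the two-sided inverse of D when D is bijective. *)
Definition gr_Across X (a : GRnode q X) (k j : 'I_N) : 'Hom(X j, X k) :=
  (gr_A a k j - (gr_B a k \o ((gr_D a)^-1 \o gr_C a j)))%VF.

Definition supporting_projection X (a : GRnode q X)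
    (P : forall k, 'End(X k)) :=
  [/\ forall k, (P k \o P k)%VF = P k,
      forall k j, (gr_A a k j @: lker (P j) <= lker (P k))%VS &
      forall k j, (gr_Across a k j @: limg (P j) <= limg (P k))%VS].

(* Compression of a to the subspaces U k, where Q k is a projection with range
   U k: on U k the map vsproj (U k) is the tautological map to subvs_of (U k),
   so vsproj (U k) \o Q k is Q k with codomain U k. *)
Definition gr_compress X (a : GRnode q X)
    (U : forall k, {vspace X k}) (Q : forall k, 'End(X k)) :
    GRnode q (fun k => subvs_of (U k) : vectType K) :=
  let prj k : 'Hom(X k, subvs_of (U k)) := (linfun (vsproj (U k)) \o Q k)%VF in
  let inj k : 'Hom(subvs_of (U k), X k) := linfun vsval in
  @GRNode K N q (fun k => subvs_of (U k) : vectType K)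
    (fun k j => (prj k \o (gr_A a k j \o inj j))%VF)
    (fun k => (prj k \o gr_B a k)%VF)
    (fun j => (gr_C a j \o inj j)%VF)
    \1%VF.

(* pr_{I - P}(a), with state spaces ker P_k; I - P_k is the projection on
   ker P_k along ran P_k. *)
Definition pr_ker X (a : GRnode q X) (P : forall k, 'End(X k)) :=
  gr_compress a (fun k => lker (P k)) (fun k => \1 - P k)%VF.

(* pr_P(a), with state spaces ran P_k. *)
Definition pr_ran X (a : GRnode q X) (P : forall k, 'End(X k)) :=
  gr_compress a (fun k => limg (P k)) P.

End Nodes.

(* Main.v *)
(* A projection is supporting exactly when the node splits, up to the similarity
   ker P_k (+) ran P_k = X_k, as the product of its two compressions; hence the
   factorization F = F'F''. It is minimal by a dimension count: the minimal dimensions of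
   F' and F'' add up to at most dim ker P_k + dim ran P_k = gamma_k.
   Conversely, let a1 and a2 be minimal realizations of F' and F''. Then a1 a2 is a
   minimal realization of F, hence similar to a, and transporting the projection of
   X'_k (+) X''_k onto X''_k along the similarity gives P. It is unique because any other
   choice would yield another similarity a1 a2 -> a, while morphisms out of a controllable
   node are determined by the input operators.
   Minimal nodes are controllable and observable, as otherwise restricting to an invariant
   family or factoring one out lowers the total dimension. For such nodes the pairs of
   states reached under the same input words form the graph of a similarity. *)
From HB Require Import structures.
Require Import Defs.
From mathcomp Require Import boolp.

Set Implicit Arguments.
Unset Strict Implicit.
Unset Printing Implicit Defensive.

Import GRing.Theory.
Local Open Scope ring_scope.

(** Splitting off the empty prefix drives the inductions on words for convolutions; [E] is arbitrary
    so that scalar, matrix and operator products are all covered. *)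
Lemma sum_split_cons (V : nmodType) (T : Type) (E : seq T -> seq T -> V) k w :
  \sum_(i < (size (k :: w)).+1) E (take i (k :: w)) (drop i (k :: w)) =
  E [::] (k :: w) + \sum_(i < (size w).+1) E (k :: take i w) (drop i w).
Proof. by rewrite big_ord_recl. Qed.

(** * The ring of formal power series *)

Section SeriesRing.
Variables (S : pzRingType) (N : nat).
Implicit Types f g h : fps S N.

Lemma fps_mul_nil f g : fps_mul f g [::] = f [::] * g [::].
Proof. by rewrite /fps_mul big_ord1. Qed.

Lemma fps_mul_cons f g k w :
  fps_mul f g (k :: w) =
  f [::] * g (k :: w) + fps_mul (fun v => f (k :: v)) g w.
Proof. exact: (sum_split_cons (fun u v => f u * g v)). Qed.

Lemma fps_mulDl f1 f2 g w :
  fps_mul (fps_add f1 f2) g w = fps_mul f1 g w + fps_mul f2 g w.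
Proof. by rewrite -big_split; apply: eq_bigr => i _; rewrite mulrDl. Qed.

Lemma fps_mulDr f g1 g2 w :
  fps_mul f (fps_add g1 g2) w = fps_mul f g1 w + fps_mul f g2 w.
Proof. by rewrite -big_split; apply: eq_bigr => i _; rewrite mulrDr. Qed.

Lemma fps_mulZl c f g w :
  fps_mul (fun v => c * f v) g w = c * fps_mul f g w.
Proof. by rewrite /fps_mul mulr_sumr; apply: eq_bigr => i _; rewrite mulrA. Qed.

(** Induction on [w] for all [f] and [g] at once: the shift of a product is again a sum of products,
    one of them with the shift of [f] as left factor. *)
Lemma fps_mulA f g h w :
  fps_mul f (fps_mul g h) w = fps_mul (fps_mul f g) h w.
Proof.
elim: w f g => [|k w IHw] f g; first by rewrite !fps_mul_nil mulrA.
rewrite !fps_mul_cons fps_mul_nil IHw.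
have -> : (fun v => fps_mul f g (k :: v)) =
    fps_add (fun v => f [::] * g (k :: v)) (fps_mul (fun v => f (k :: v)) g).
  by apply/funext => v; rewrite fps_mul_cons.
by rewrite fps_mulDl fps_mulZl mulrDr !mulrA addrA.
Qed.

Lemma fps_mul1l f w : fps_mul fps_one f w = f w.
Proof.
rewrite /fps_mul big_ord_recl take0 drop0 mul1r big1 ?addr0 // => i _.
by case: w i => [[]|k w i] //=; rewrite mul0r.
Qed.

Lemma fps_mul1r f w : fps_mul f fps_one w = f w.
Proof.
rewrite /fps_mul big_ord_recr /= take_size drop_size mulr1 big1 ?add0r // => i _.
case: drop (size_drop i w) => [|k v _] /=; last by rewrite mulr0.
by move/esym/eqP; rewrite subn_eq0 leqNgt ltn_ord.
Qed.

(* An alias carrying the convolution ring structure; fps S N itself unfolds to a function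
   type. *)
Definition series : Type := fps S N.

HB.instance Definition _ := gen_eqMixin series.
HB.instance Definition _ := gen_choiceMixin series.

Definition series_opp (f : series) : series := fun w => - f w.

Fact series_addA : associative (@fps_add S N : series -> series -> series).
Proof. by move=> f g h; apply/funext => w; rewrite /fps_add addrA. Qed.
Fact series_addC : commutative (@fps_add S N : series -> series -> series).
Proof. by move=> f g; apply/funext => w; rewrite /fps_add addrC. Qed.
Fact series_add0 : left_id (fun=> 0) (@fps_add S N : series -> series -> series).
Proof. by move=> f; apply/funext => w; rewrite /fps_add add0r. Qed.
Fact series_addN :
  left_inverse (fun=> 0) series_opp (@fps_add S N : series -> series -> series).
Proof. by move=> f; apply/funext => w; rewrite /fps_add addNr. Qed.

HB.instance Definition _ :=
  GRing.isZmodule.Build series series_addA series_addC series_add0 series_addN.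

Fact series_mulA : associative (@fps_mul S N : series -> series -> series).
Proof. by move=> f g h; apply/funext => w; rewrite fps_mulA. Qed.
Fact series_mul1l : left_id fps_one (@fps_mul S N : series -> series -> series).
Proof. by move=> f; apply/funext => w; rewrite fps_mul1l. Qed.
Fact series_mul1r : right_id fps_one (@fps_mul S N : series -> series -> series).
Proof. by move=> f; apply/funext => w; rewrite fps_mul1r. Qed.
Fact series_mulDl :
  left_distributive (@fps_mul S N : series -> series -> series) +%R.
Proof. by move=> f g h; apply/funext => w; rewrite fps_mulDl. Qed.
Fact series_mulDr :
  right_distributive (@fps_mul S N : series -> series -> series) +%R.
Proof. by move=> f g h; apply/funext => w; rewrite fps_mulDr. Qed.

HB.instance Definition _ := GRing.Zmodule_isPzRing.Build series
  series_mulA series_mul1l series_mul1r series_mulDl series_mulDr.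

Implicit Types F G : series.

Lemma seriesDE F G w : (F + G) w = F w + G w. Proof. by []. Qed.
Lemma seriesNE F w : (- F) w = - F w. Proof. by []. Qed.
Lemma seriesME F G w : (F * G) w = fps_mul F G w. Proof. by []. Qed.

Lemma series_sumE (I : Type) (r : seq I) (P : pred I) (F : I -> series) w :
  (\sum_(i <- r | P i) F i) w = \sum_(i <- r | P i) F i w.
Proof. by elim/big_rec2: _ => // i x y _ <-. Qed.

Lemma series_exp_small F n w : F [::] = 0 -> (size w < n)%N -> (F ^+ n) w = 0.
Proof.
move=> F0; elim: n w => [//|n IHn] w ltwn; rewrite exprS seriesME /fps_mul.
apply: big1 => i _; case: i => -[|i] ltiw /=; first by rewrite take0 F0 mul0r.
case: w ltwn ltiw => [|k w] //= ltwn _; rewrite IHn ?mulr0 // size_drop.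
by apply: leq_ltn_trans (leq_subr _ _) _; rewrite -ltnS.
Qed.

(* \sum_n F^n: when F has no constant term, powers beyond the length of w vanish at w. *)
Definition geom F : series := fun w => \sum_(n < (size w).+1) (F ^+ n) w.

(** Lets all prefixes or suffixes of a word share one truncation order, so that finite sums can be
    exchanged with products. *)
Lemma geomE F m w : F [::] = 0 -> (size w < m)%N ->
  geom F w = \sum_(n < m) (F ^+ n) w.
Proof.
move=> F0 ltwm; rewrite /geom (big_ord_widen m (fun n => (F ^+ n) w)) //.
rewrite big_mkcond; apply: eq_bigr => n _; case: ifP => // /negbT.
by rewrite -leqNgt => ?; rewrite series_exp_small.
Qed.

Lemma geom_mulr F : F [::] = 0 -> F * geom F = geom F - 1.
Proof.
move=> F0; apply/funext => w; rewrite seriesDE seriesNE seriesME.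
(* With length plus two powers, the power 0 cancels against [- 1] and the remaining ones are the
   powers below length plus one, each multiplied by [F]. *)
rewrite (@geomE _ (size w).+2) // big_ord_recl [X in _ = X + _ - _]/= addrC addKr.
transitivity ((F * \sum_(i < (size w).+1) F ^+ i) w); last first.
  by rewrite mulr_sumr series_sumE; apply: eq_bigr => i _; rewrite exprS.
rewrite seriesME; apply: eq_bigr => i _; congr (_ * _).
by rewrite (@geomE _ (size w).+1) ?series_sumE // ltnS size_drop leq_subr.
Qed.

Lemma geom_mull F : F [::] = 0 -> geom F * F = geom F - 1.
Proof.
move=> F0; apply/funext => w; rewrite seriesDE seriesNE seriesME.
rewrite (@geomE _ (size w).+2) // big_ord_recl [X in _ = X + _ - _]/= addrC addKr.
transitivity (((\sum_(i < (size w).+1) F ^+ i) * F) w); last first.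
  by rewrite mulr_suml series_sumE; apply: eq_bigr => i _; rewrite exprSr.
rewrite seriesME; apply: eq_bigr => i _; congr (_ * _).
by rewrite (@geomE _ (size w).+1) ?series_sumE // ltnS size_take; case: ltnP => // /ltnW.
Qed.

End SeriesRing.

(** * Rational series *)

Section RationalClosure.
Variables (K : fieldType) (N : nat).
Implicit Types f g : series K N.

Let ratl (f : series K N) := @fps_rational K N f.

Definition series_const (c : K) : series K N := fun w => if w is [::] then c else 0.
Definition series_letter (k : 'I_N) : series K N :=
  fun w => if w == [:: k] then 1 else 0.

Lemma series_constM c f w : (series_const c * f) w = c * f w.
Proof.
rewrite -{2}(mul1r f) !seriesME -fps_mulZl; apply: eq_bigr => i _; congr (_ * _).
by case: take => [|? ?] /=; rewrite ?mulr1 ?mulr0.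
Qed.

Lemma series_letterM k f w :
  (series_letter k * f) w = if w is j :: v then if j == k then f v else 0 else 0.
Proof.
case: w => [|j v]; first by rewrite seriesME fps_mul_nil mul0r.
rewrite seriesME fps_mul_cons mul0r add0r.
have -> : (fun u => series_letter k (j :: u)) = series_const (j == k)%:R.
  apply/funext => -[|i u]; rewrite /series_letter eqseq_cons ?andbT ?andbF //=.
  by case: eqP.
rewrite -[LHS]/((series_const _ * f) v) series_constM.
by case: eqP => _; rewrite ?mul1r ?mul0r.
Qed.

Lemma rational_const c : ratl (series_const c).
Proof. by apply: RatPoly; exists [:: [::]] => -[|]. Qed.

Lemma rational_letter k : ratl (series_letter k).
Proof.
by apply: RatPoly; exists [:: [:: k]] => w; rewrite inE /series_letter => /negPf->.
Qed.

Lemma rational_add f g : ratl f -> ratl g -> ratl (f + g).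
Proof. exact: RatAdd. Qed.

Lemma rational_mul f g : ratl f -> ratl g -> ratl (f * g).
Proof. exact: RatMul. Qed.

Lemma rational0 : ratl 0.
Proof. by apply: RatPoly; exists [::]. Qed.

Lemma rational_opp f : ratl f -> ratl (- f).
Proof.
move=> fr; suff -> : - f = series_const (-1) * f.
  exact/rational_mul/fr/rational_const.
by apply/funext => w; rewrite series_constM mulN1r.
Qed.

Lemma rational_sum (I : Type) (r : seq I) (P : pred I) (f : I -> series K N) :
  (forall i, ratl (f i)) -> ratl (\sum_(i <- r | P i) f i).
Proof.
move=> fr; elim/big_ind: _ => //; [exact: rational0 | exact: rational_add].
Qed.

(** The geometric series is the two-sided inverse of [1 - f], whose constant term is 1. *)
Lemma rational_geom f : ratl f -> f [::] = 0 -> ratl (geom f).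
Proof.
move=> fr f0; apply: (@RatInv _ _ (1 - f : series K N)).
- exact/rational_add/rational_opp/fr/rational_const.
- by rewrite seriesDE seriesNE f0 subr0 oner_eq0.
- move=> w; rewrite -[LHS]/(((1 - f) * geom f) w).
  by rewrite mulrBl mul1r geom_mulr // opprB addrCA subrr addr0.
- move=> w; rewrite -[LHS]/((geom f * (1 - f)) w).
  by rewrite mulrBr mulr1 geom_mull // opprB addrCA subrr addr0.
Qed.

(* Gaussian elimination: the last equation expresses h_n through the other unknowns since
   1 - M_nn has constant term 1. *)
Lemma rational_linear_system n (h b : 'I_n -> series K N)
    (M : 'I_n -> 'I_n -> series K N) :
  (forall i, ratl (b i)) -> (forall i j, ratl (M i j)) ->
  (forall i j, M i j [::] = 0) ->
  (forall i, h i = b i + \sum_j M i j * h j) -> forall i, ratl (h i).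
Proof.
elim: n h b M => [|n IHn] h b M br Mr M0 hE; first by case.
pose m := ord_max : 'I_n.+1; pose wd (i : 'I_n) : 'I_n.+1 := widen_ord (leqnSn n) i.
pose g := geom (M m m).
have gr : ratl g by apply: rational_geom.
have hm : h m = g * b m + \sum_(j < n) g * M m (wd j) * h (wd j).
  have e : h m - M m m * h m = b m + \sum_(j < n) M m (wd j) * h (wd j).
    by rewrite {1}hE big_ord_recr /= addrA addrK.
  transitivity (g * (h m - M m m * h m)).
    rewrite mulrBr mulrA geom_mull // mulrBl mul1r opprB addrCA subrr addr0 //.
  rewrite e mulrDr mulr_sumr; congr (_ + _).
  by apply: eq_bigr => j _; rewrite mulrA.
(* Substituting [hm] removes the last unknown; the new coefficients still have no constant term. *)
have hwd i : ratl (h (wd i)).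
  apply: (IHn (fun i => h (wd i)) (fun i => b (wd i) + M (wd i) m * (g * b m))
    (fun i j => M (wd i) (wd j) + M (wd i) m * (g * M m (wd j)))) => {i}.
  - by move=> i; apply: rational_add => //; do 2!apply: rational_mul => //.
  - by move=> i j; apply: rational_add => //; do 2!apply: rational_mul => //.
  - by move=> i j; rewrite seriesDE seriesME fps_mul_nil !M0 mul0r addr0.
  move=> i; rewrite {1}hE big_ord_recr /= -/m hm mulrDr -addrA; congr (_ + _).
  rewrite addrCA; congr (_ + _); rewrite mulr_sumr -big_split; apply: eq_bigr => j _.
  by rewrite mulrDl !mulrA.
move=> i; case: (unliftP ord_max i) => [j ->|->].
  by rewrite (_ : lift _ _ = wd j) //; apply/val_inj; rewrite /= /bump leqNgt ltn_ord.
rewrite hm; apply: rational_add; first exact: rational_mul.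
by apply: rational_sum => j; do 2?apply: rational_mul.
Qed.

End RationalClosure.

(** * Recognizable series *)

Section Recognizable.
Variables (K : fieldType) (N : nat).

(** A linear representation: unfolding the recursion gives [F w] as [c] times the product of the
    [M k] along [w] times [h [::]]. Keeping [h] as a datum reduces closure proofs to exhibiting a
    recursion. *)
Definition recognizable p q (F : seq 'I_N -> 'M[K]_(p, q)) :=
  exists n (M : 'I_N -> 'M[K]_n) (h : seq 'I_N -> 'M[K]_(n, q)) (c : 'M[K]_(p, n)),
    (forall k w, h (k :: w) = M k *m h w) /\ (forall w, F w = c *m h w).

Lemma eq_recognizable p q (F G : seq 'I_N -> 'M[K]_(p, q)) :
  F =1 G -> recognizable F -> recognizable G.
Proof. by move/funext->. Qed.

(** The new state stacks [F] on top of [h], so the value of [F] at the empty word is free. *)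
Lemma recognizable_shift p q n (F : seq 'I_N -> 'M[K]_(p, q))
    (M : 'I_N -> 'M[K]_n) (h : seq 'I_N -> 'M[K]_(n, q)) (c : 'I_N -> 'M[K]_(p, n)) :
  (forall k w, h (k :: w) = M k *m h w) ->
  (forall k w, F (k :: w) = c k *m h w) -> recognizable F.
Proof.
move=> hE FE; exists (p + n)%N, (fun k => block_mx 0 (c k) 0 (M k)).
exists (fun w => col_mx (F w) (h w)), (row_mx 1%:M 0); split=> [k w|w].
  by rewrite mul_block_col !mul0mx !add0r hE FE.
by rewrite mul_row_col mul1mx mul0mx addr0.
Qed.

Lemma recognizable_add p q (F G : seq 'I_N -> 'M[K]_(p, q)) :
  recognizable F -> recognizable G -> recognizable (fun w => F w + G w).
Proof.
move=> [n [M [h [c [hE FE]]]]] [n' [M' [h' [c' [hE' GE]]]]].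
exists (n + n')%N, (fun k => block_mx (M k) 0 0 (M' k)).
exists (fun w => col_mx (h w) (h' w)), (row_mx c c'); split=> [k w|w].
  by rewrite mul_block_col !mul0mx addr0 add0r hE hE'.
by rewrite mul_row_col FE GE.
Qed.

Lemma recognizable_const0 p q (A : 'M[K]_(p, q)) :
  recognizable (fun w => if w is [::] then A else 0).
Proof.
apply: (@recognizable_shift _ _ 0 _ (fun=> 0) (fun=> 0) (fun=> 0)) => k w;
  by rewrite mul0mx.
Qed.

Lemma recognizable_sum p q (I : Type) (r : seq I) (F : I -> seq 'I_N -> 'M[K]_(p, q)) :
  (forall i, recognizable (F i)) -> recognizable (fun w => \sum_(i <- r) F i w).
Proof.
move=> Fr; elim: r => [|i r IHr].
  by apply: eq_recognizable (recognizable_const0 0) => -[|k w]; rewrite big_nil.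
apply: eq_recognizable (recognizable_add (Fr i) IHr) => w; by rewrite big_cons.
Qed.

Lemma recognizable_mulmxl p p' q (A : 'M[K]_(p', p)) (F : seq 'I_N -> 'M[K]_(p, q)) :
  recognizable F -> recognizable (fun w => A *m F w).
Proof.
move=> [n [M [h [c [hE FE]]]]]; exists n, M, h, (A *m c); split=> // w.
by rewrite FE mulmxA.
Qed.

Lemma recognizable_mulmxr p q q' (A : 'M[K]_(q, q')) (F : seq 'I_N -> 'M[K]_(p, q)) :
  recognizable F -> recognizable (fun w => F w *m A).
Proof.
move=> [n [M [h [c [hE FE]]]]]; exists n, M, (fun w => h w *m A), c.
by split=> [k w|w]; rewrite ?hE ?FE mulmxA.
Qed.

Lemma recognizable_letterM p q k (F : seq 'I_N -> 'M[K]_(p, q)) :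
  recognizable F ->
  recognizable (fun w => if w is j :: v then if j == k then F v else 0 else 0).
Proof.
move=> [n [M [h [c [hE FE]]]]].
apply: (@recognizable_shift _ _ n _ M h (fun j => if j == k then c else 0)) => // j w.
by case: eqP => _; rewrite ?FE ?mul0mx.
Qed.

(** Induction on the length bound: [F] is its constant term plus the sum over letters [k] of [k]
    times the shift of [F] by [k]. *)
Lemma recognizable_poly p q (F : seq 'I_N -> 'M[K]_(p, q)) n :
  (forall w, (n <= size w)%N -> F w = 0) -> recognizable F.
Proof.
elim: n F => [|n IHn] F F0.
  by apply: eq_recognizable (recognizable_const0 0) => -[|k w]; rewrite F0.
have sr k : recognizable (fun w => F (k :: w)) by apply: IHn => w ?; exact: F0.
apply: eq_recognizable (recognizable_add (recognizable_const0 (F [::]))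
  (recognizable_sum (index_enum 'I_N) (fun k => recognizable_letterM k (sr k)))).
case=> [|j w]; first by rewrite big1 ?addr0.
rewrite add0r (bigD1 j) //= eqxx big1 ?addr0 // => k /negPf.
by rewrite eq_sym => ->.
Qed.

(** The rectangular counterpart of [fps_mul], which allows a state function to be convolved with a
    series. *)
Definition convmx p r q (F : seq 'I_N -> 'M[K]_(p, r))
    (G : seq 'I_N -> 'M[K]_(r, q)) w :=
  \sum_(i < (size w).+1) F (take i w) *m G (drop i w).

Lemma convmx_cons p r q (F : seq 'I_N -> 'M[K]_(p, r))
    (G : seq 'I_N -> 'M[K]_(r, q)) k w :
  convmx F G (k :: w) = F [::] *m G (k :: w) + convmx (fun v => F (k :: v)) G w.
Proof. exact: (sum_split_cons (fun u v => F u *m G v)). Qed.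

Lemma convmx_mull p' p r q (A : 'M[K]_(p', p)) (F : seq 'I_N -> 'M[K]_(p, r))
    (G : seq 'I_N -> 'M[K]_(r, q)) w :
  convmx (fun v => A *m F v) G w = A *m convmx F G w.
Proof. by rewrite /convmx mulmx_sumr; apply: eq_bigr => i _; rewrite mulmxA. Qed.

(* The state is the pair (h * G, h'), where
   (h * G)(k w) = h([::]) G(k w) + M_k (h * G)(w). *)
Lemma recognizable_conv p r q (F : seq 'I_N -> 'M[K]_(p, r))
    (G : seq 'I_N -> 'M[K]_(r, q)) :
  recognizable F -> recognizable G -> recognizable (convmx F G).
Proof.
move=> [n [M [h [c [hE FE]]]]] [n' [M' [h' [c' [hE' GE]]]]].
exists (n + n')%N, (fun k => block_mx (M k) (h [::] *m c' *m M' k) 0 (M' k)).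
exists (fun w => col_mx (convmx h G w) (h' w)), (row_mx c 0); split=> [k w|w].
  rewrite mul_block_col mul0mx add0r -hE' convmx_cons GE hE' addrC !mulmxA.
  rewrite -convmx_mull (_ : (fun v => h (k :: v)) = fun v => M k *m h v) //.
  exact/funext.
rewrite mul_row_col mul0mx addr0 -convmx_mull (_ : F = fun v => c *m h v) //.
exact/funext.
Qed.

Lemma scalar_convmx (f g : fps K N) w :
  convmx (fun v => (f v)%:M : 'M[K]_1) (fun v => (g v)%:M) w = (fps_mul f g w)%:M.
Proof. by rewrite /fps_mul rmorph_sum; apply: eq_bigr => i _; rewrite /= scalar_mxM. Qed.

(* The state h * g is closed under shifts: since f * g = 1, g(k w) is a multiple of
   (shift of f by k) * g at w, which is c M_k (h * g)(w). *)
Lemma recognizable_inv (f g : fps K N) :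
  f [::] != 0 -> fps_mul f g =1 fps_one ->
  recognizable (fun w => (f w)%:M : 'M[K]_1) ->
  recognizable (fun w => (g w)%:M : 'M[K]_1).
Proof.
move=> f0 fg [n [M [h [c [hE FE]]]]].
pose G w := (g w)%:M : 'M[K]_1; pose d k := - (f [::])^-1 *: (c *m M k).
have GE k w : G (k :: w) = d k *m convmx h G w.
  have := fg (k :: w); rewrite fps_mul_cons /= => /eqP; rewrite addr_eq0 => /eqP fgE.
  rewrite /G; have -> : g (k :: w) = - (f [::])^-1 * fps_mul (fun v => f (k :: v)) g w.
    by rewrite -[LHS](mulKf f0) fgE mulrN mulNr.
  rewrite scalar_mxM mul_scalar_mx -scalemxAl -scalar_convmx -mulmxA -!convmx_mull.
  congr (_ *: _).
  rewrite (_ : (fun v => (f (k :: v))%:M) = fun v => c *m (M k *m h v)) //.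
  by apply/funext => v; rewrite FE hE.
apply: (recognizable_shift (M := fun k => h [::] *m d k + M k) (h := convmx h G) _ GE).
move=> k w; rewrite convmx_cons GE mulmxDl mulmxA; congr (_ + _).
rewrite -convmx_mull (_ : (fun v => h (k :: v)) = fun v => M k *m h v) //.
exact/funext.
Qed.

Lemma rational_recognizable (f : fps K N) :
  fps_rational f -> recognizable (fun w => (f w)%:M : 'M[K]_1).
Proof.
elim=> {f} [f [s s0]|f g _ fr _ gr|f g _ fr _ gr|f g _ fr f0 fg _].
(* A polynomial vanishes on words longer than all those in its list [s]. *)
- apply: (@recognizable_poly _ _ _ (\max_(w <- s) size w).+1) => w ltw.
  rewrite s0 ?raddf0 //; apply: contraL ltw => ws.
  rewrite -leqNgt.
  exact: (leq_bigmax_seq (F := size) w ws).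
- by apply: eq_recognizable (recognizable_add fr gr) => w; rewrite -raddfD.
- by apply: eq_recognizable (recognizable_conv fr gr) => w; rewrite scalar_convmx.
- exact: recognizable_inv fr.
Qed.

(** Each entry, as a 1 by 1 series, is placed by a unit column and a unit row; the results are added
    up. *)
Lemma mx_rational_recognizable q (F : fps 'M[K]_q N) :
  mx_fps_rational F -> recognizable F.
Proof.
move=> Fr; have Er i j : recognizable (fun w => (F w i j) *: delta_mx i j : 'M[K]_q).
  apply: eq_recognizable (recognizable_mulmxl (delta_mx i 0)
    (recognizable_mulmxr (delta_mx 0 j) (rational_recognizable (Fr i j)))) => w.
  by rewrite mul_scalar_mx -scalemxAr mul_delta_mx.
apply: eq_recognizable (recognizable_sum (index_enum 'I_q)
  (fun i => recognizable_sum (index_enum 'I_q) (Er i))) => w.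
by rewrite [RHS]matrix_sum_delta.
Qed.

End Recognizable.

(** * Morphisms, controllability and observability of nodes *)

(** The span of a possibly infinite family, found as a subspace of least dimension containing it:
    intersecting with another such [E] cannot lower the dimension. *)
Lemma vspan_family (K : fieldType) (V : vectType K) (I : Type) (v : I -> V) :
  exists S : {vspace V}, (forall i, v i \in S) /\
    (forall E : {vspace V}, (forall i, v i \in E) -> (S <= E)%VS).
Proof.
pose P n := `[< exists S : {vspace V}, \dim S = n /\ forall i, v i \in S >].
have exP : exists n, P n.
  by exists (\dim {:V}); apply/asboolP; exists fullv; split=> // i; exact: memvf.
case: (ex_minnP exP) => n /asboolP[S [dS vS]] minS; exists S; split=> // E vE.
have /minS : P (\dim (S :&: E)).
  by apply/asboolP; exists (S :&: E)%VS; split=> // i; rewrite memv_cap vS vE.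
by rewrite -dS (geq_leqif (dimv_leqif_sup (capvSl S E))) subv_cap => /andP[].
Qed.

Lemma mulmx_cV_ext (K : fieldType) p q (A B : 'M[K]_(p, q)) :
  (forall u : 'cV_q, A *m u = B *m u) -> A = B.
Proof.
move=> AB; apply/matrixP => i j; have := AB (delta_mx j 0).
by rewrite -!colE => /colP/(_ i); rewrite !mxE.
Qed.

Section PairMaps.
Variables (K : fieldType) (V W : vectType K).

Definition lfst : 'Hom((V * W)%type, V) := linfun fst.
Definition lsnd : 'Hom((V * W)%type, W) := linfun snd.

Lemma lfstE z : lfst z = z.1. Proof. by rewrite lfunE. Qed.
Lemma lsndE z : lsnd z = z.2. Proof. by rewrite lfunE. Qed.

Definition pair0r (x : V) : V * W := (x, 0).
Definition pair0l (y : W) : V * W := (0, y).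

Fact pair0r_linear : linear pair0r.
Proof. by move=> c x y; congr pair; rewrite /= scaler0 addr0. Qed.
Fact pair0l_linear : linear pair0l.
Proof. by move=> c x y; congr pair; rewrite /= scaler0 addr0. Qed.

HB.instance Definition _ :=
  GRing.isLinear.Build K V (V * W)%type *:%R pair0r pair0r_linear.
HB.instance Definition _ :=
  GRing.isLinear.Build K W (V * W)%type *:%R pair0l pair0l_linear.

Definition linl : 'Hom(V, (V * W)%type) := linfun pair0r.
Definition linr : 'Hom(W, (V * W)%type) := linfun pair0l.

Lemma linlE x : linl x = (x, 0). Proof. by rewrite lfunE. Qed.
Lemma linrE y : linr y = (0, y). Proof. by rewrite lfunE. Qed.

End PairMaps.

Arguments lfst {K V W}.
Arguments lsnd {K V W}.
Arguments linl {K V W}.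
Arguments linr {K V W}.

Definition lpair (K : fieldType) (V W V' W' : vectType K) (f : 'Hom(V, V'))
    (g : 'Hom(W, W')) : 'Hom((V * W)%type, (V' * W')%type) :=
  ((linl \o f \o lfst) + (linr \o g \o lsnd))%VF.

Lemma lpairE (K : fieldType) (V W V' W' : vectType K) (f : 'Hom(V, V'))
    (g : 'Hom(W, W')) z : lpair f g z = (f z.1, g z.2).
Proof.
rewrite /lpair add_lfunE !comp_lfunE lfstE lsndE linlE linrE.
by congr pair; rewrite /= ?addr0 ?add0r.
Qed.

Section NodeTheory.
Variables (K : fieldType) (N q : nat).
Implicit Types X Y : 'I_N -> vectType K.

Lemma transfer_nil X (a : GRnode q X) u : transfer a [::] *m u = gr_D a u.
Proof. exact: mx_of_endE. Qed.

Lemma transfer_cons X (a : GRnode q X) j w u :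
  transfer a (j :: w) *m u = gr_C a j (state_coef a w j u).
Proof. by rewrite mx_of_endE comp_lfunE. Qed.

Lemma realization_D1 X (a : GRnode q X) F :
  F [::] = 1%:M -> gr_realization a F -> gr_D a = \1%VF.
Proof.
move=> F1 aF; apply/lfunP => u.
by rewrite -transfer_nil aF F1 mul1mx id_lfunE.
Qed.

Lemma compress_AE X (a : GRnode q X) U Q k j x :
  gr_A (gr_compress a U Q) k j x = vsproj (U k) (Q k (gr_A a k j (vsval x))).
Proof. by rewrite /= !comp_lfunE !lfunE. Qed.

Lemma compress_BE X (a : GRnode q X) U Q k u :
  gr_B (gr_compress a U Q) k u = vsproj (U k) (Q k (gr_B a k u)).
Proof. by rewrite /= !comp_lfunE !lfunE. Qed.

Lemma compress_CE X (a : GRnode q X) U Q k x :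
  gr_C (gr_compress a U Q) k x = gr_C a k (vsval x).
Proof. by rewrite /= !comp_lfunE !lfunE. Qed.

(** Separated from the output condition because inputs and state maps alone determine a map out of a
    controllable node. *)
Definition intertwines X Y (a : GRnode q X) (b : GRnode q Y)
    (T : forall k, 'Hom(X k, Y k)) :=
  (forall k u, T k (gr_B a k u) = gr_B b k u) /\
  (forall k j x, T k (gr_A a k j x) = gr_A b k j (T j x)).

Definition node_morphism X Y (a : GRnode q X) (b : GRnode q Y)
    (T : forall k, 'Hom(X k, Y k)) :=
  intertwines a b T /\ (forall k x, gr_C b k (T k x) = gr_C a k x).

Lemma intertwines_state X Y (a : GRnode q X) (b : GRnode q Y) T :
  intertwines a b T ->
  forall w j u, T j (state_coef a w j u) = state_coef b w j u.
Proof.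
move=> [TB TA]; elim=> [|k w IHw] j u /=; first exact: TB.
by rewrite !comp_lfunE TA IHw.
Qed.

Lemma morphism_transfer X Y (a : GRnode q X) (b : GRnode q Y) T :
  gr_D a = gr_D b -> node_morphism a b T -> transfer a =1 transfer b.
Proof.
move=> Dab [Tab TC] [|j w]; apply: mulmx_cV_ext => u; first by rewrite !transfer_nil Dab.
by rewrite !transfer_cons -(intertwines_state Tab) TC.
Qed.

(** Phrased by invariant families instead of ranks: the reached states span the smallest family
    closed under [gr_A] that contains the ranges of [gr_B]. *)
Definition controllable X (a : GRnode q X) :=
  forall U : forall k, {vspace X k},
    (forall k u, gr_B a k u \in U k) ->
    (forall k j x, x \in U j -> gr_A a k j x \in U k) ->
    forall k, U k = fullv.

Definition observable X (a : GRnode q X) :=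
  forall V : forall k, {vspace X k},
    (forall k x, x \in V k -> gr_C a k x = 0) ->
    (forall k j x, x \in V j -> gr_A a k j x \in V k) ->
    forall k, V k = 0%VS.

(** The kernels of [T k - T' k] form an invariant family containing all inputs. *)
Lemma intertwines_unique X Y (a : GRnode q X) (b : GRnode q Y) T T' :
  controllable a -> intertwines a b T -> intertwines a b T' ->
  forall k x, T k x = T' k x.
Proof.
move=> ac [TB TA] [TB' TA'] k x.
suff Uf : lker (T k - T' k) = fullv.
  by apply/eqlfunP; rewrite Uf memvf.
apply: (ac (fun k => lker (T k - T' k))) => [l u|l j y /eqlfunP Ty]; apply/eqlfunP.
  by rewrite TB TB'.
by rewrite TA TA' Ty.
Qed.

Definition total_dim X := (\sum_k \dim {: X k})%N.

(** Turns a bound on total dimensions into information at each index. *)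
Lemma sum_leq_eq (d e : 'I_N -> nat) :
  (forall k, d k <= e k)%N -> (\sum_k e k <= \sum_k d k)%N -> forall k, d k = e k.
Proof.
move=> de sed k; apply/eqP.
have := leqif_sum (P := predT) (fun i _ => leqif_eq (de i)).
by move/geq_leqif; rewrite sed => /esym/forall_inP/(_ k isT).
Qed.

Lemma dim_subvsf (V : vectType K) (U : {vspace V}) : \dim {: subvs_of U} = \dim U.
Proof. by rewrite dimvf. Qed.

Lemma dim_full_eq (V : vectType K) (U : {vspace V}) : \dim U = \dim {: V} -> U = fullv.
Proof. by move=> dU; apply/eqP; rewrite eqEdim subvf dU leqnn. Qed.

(** * Nodes of smallest total dimension *)

Section SmallestTotalDim.
Variables (X : 'I_N -> vectType K) (a : GRnode q X).
Hypothesis aD : gr_D a = \1%VF.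
Hypothesis amin : forall Y (b : GRnode q Y),
  transfer b =1 transfer a -> (total_dim X <= total_dim Y)%N.

Lemma smallest_controllable : controllable a.
Proof.
move=> U BU AU.
(* The choice of projection onto [U k] is immaterial: inputs and images of [U] under [gr_A] already
   lie in [U k]. *)
pose b := gr_compress a U (fun k => projv (U k)).
have ba : transfer b =1 transfer a.
  apply: (@morphism_transfer _ _ b a (fun k => linfun vsval)); first by rewrite aD.
  split=> [|k x]; last by rewrite compress_CE lfunE.
  split=> [k u|k j x].
    by rewrite compress_BE lfunE projv_id ?BU //; exact: (vsprojK (BU k u)).
  have AUx := AU k j _ (subvsP x).
  by rewrite compress_AE !lfunE projv_id ?AUx //; exact: (vsprojK AUx).
have dU k : \dim (U k) = \dim {: X k}.
  apply: (sum_leq_eq (d := fun k => \dim (U k)) (e := fun k => \dim {: X k})) => [l|].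
    exact/dimvS/subvf.
  rewrite (leq_trans (amin ba)) //; apply: leq_sum => l _.
  by rewrite dim_subvsf.
by move=> k; exact: dim_full_eq.
Qed.

(** The quotient by [V k] is modelled on a complement of [V k]; projecting along [V k] is a morphism
    because the error [x - Q k x] stays in [V] under [gr_A] and is killed by [gr_C]. *)
Lemma smallest_observable : observable a.
Proof.
move=> V CV AV.
pose Q k := daddv_pi (V k)^C (V k).
have cap0 k : ((V k)^C :&: V k = 0)%VS by rewrite capvC capv_compl.
have QV k x : x - Q k x \in V k.
  have e : Q k x + daddv_pi (V k) (V k)^C x = x.
    by apply: daddv_pi_add; rewrite ?cap0 // addvC addv_complf memvf.
  by rewrite -{1}e addrC addKr memv_pi.
have Q0 k x : x \in V k -> Q k x = 0.
  move=> xV; have : Q k x \in ((V k)^C :&: V k)%VS.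
    by rewrite memv_cap memv_pi -[X in X \in V k](subKr x) rpredB ?QV.
  by rewrite cap0 memv0 => /eqP.
pose b := gr_compress a (fun k => (V k)^C)%VS Q.
pose T k : 'Hom(X k, subvs_of (V k)^C) := (linfun (vsproj _) \o Q k)%VF.
have TE k x : T k x = vsproj _ (Q k x) by rewrite comp_lfunE lfunE.
have ab : transfer a =1 transfer b.
  apply: (@morphism_transfer _ _ a b T); first by rewrite aD.
  have vT k x : vsval (T k x) = Q k x by rewrite TE vsprojK ?memv_pi.
  split=> [|k x].
    split=> [k u|k j x]; first by rewrite compress_BE TE.
    rewrite compress_AE vT TE; congr vsproj; apply/eqP.
    by rewrite -subr_eq0 -!linearB; apply/eqP/Q0/AV/QV.
  rewrite compress_CE vT; apply/eqP.
  by rewrite eq_sym -subr_eq0 -linearB; apply/eqP/CV/QV.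
have dV k : (\dim {: X k} - \dim (V k))%N = \dim {: X k}.
  apply: (sum_leq_eq (d := fun k => (\dim {: X k} - \dim (V k))%N)
    (e := fun k => \dim {: X k})) => [l|]; first exact: leq_subr.
  rewrite (leq_trans (amin (fsym ab))) //; apply: leq_sum => l _.
  by rewrite dim_subvsf dimv_compl.
move=> k; apply/eqP; rewrite -dimv_eq0.
have := subKn (dimvS (subvf (V k))); rewrite dV subnn => <-; exact: eqxx.
Qed.

End SmallestTotalDim.

(** * Similarity of nodes with the same transfer function *)

Section Graph.
Variables (X Y : 'I_N -> vectType K) (a : GRnode q X) (b : GRnode q Y).
Hypothesis ab : transfer a =1 transfer b.

(* The pairs of states reached by a and b under the same input words span the graph of
   the similarity between a and b. *)
Lemma state_graph :
  exists G : forall k, {vspace (X k * Y k)%type},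
    [/\ forall k u, (gr_B a k u, gr_B b k u) \in G k,
        forall k j z, z \in G j -> (gr_A a k j z.1, gr_A b k j z.2) \in G k &
        forall k z, z \in G k -> gr_C a k z.1 = gr_C b k z.2].
Proof.
pose st k (i : seq 'I_N * 'cV[K]_q) : (X k * Y k)%type :=
  (state_coef a i.1 k i.2, state_coef b i.1 k i.2).
pose G k := sval (cid (vspan_family (st k))).
have stG k i : st k i \in G k by rewrite /G; case: cid => S [].
have Gle k (E : {vspace (X k * Y k)%type}) : (forall i, st k i \in E) -> (G k <= E)%VS.
  by rewrite /G; case: cid => S [] ? /=; exact.
exists G; split=> [k u|k j z zG|k z zG].
- exact: (stG k ([::], u)).
(* Invariance is checked on the generating pairs only, by placing them in the preimage of [G k]. *)
- have /subvP/(_ z zG) : (G j <= lpair (gr_A a k j) (gr_A b k j) @^-1: G k)%VS.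
    apply: Gle => -[w u]; rewrite -memv_preim lpairE /st /=.
    by have := stG k (j :: w, u); rewrite /st /= !comp_lfunE.
  by rewrite -memv_preim lpairE.
- have /subvP/(_ z zG) :
      (G k <= lker ((gr_C a k \o lfst)%VF - (gr_C b k \o lsnd)%VF)%R)%VS.
    apply: Gle => -[w u]; apply/eqlfunP; rewrite !comp_lfunE lfstE lsndE /=.
    by rewrite -!transfer_cons ab.
  by move/eqlfunP; rewrite !comp_lfunE lfstE lsndE.
Qed.

Hypotheses (ac : controllable a) (ao : observable a).

(** The first projections of [G] form an invariant family containing the inputs, and the [x] with
    [(x, 0)] in [G] form an invariant family without output. So [G k] is the graph of a map from a
    subspace of [Y k] onto [X k]. *)
Lemma state_graph_dim :
  exists G : forall k, {vspace (X k * Y k)%type},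
    [/\ forall k u, (gr_B a k u, gr_B b k u) \in G k,
        forall k j z, z \in G j -> (gr_A a k j z.1, gr_A b k j z.2) \in G k,
        forall k z, z \in G k -> gr_C a k z.1 = gr_C b k z.2,
        forall k, (lfst @: G k)%VS = fullv &
        forall k, (G k :&: lker lsnd)%VS = 0%VS].
Proof.
have [G [GB GA GC]] := state_graph; exists G; split=> //.
  apply: ac => [k u|k j x /memv_imgP[z zG ->]].
    by have := memv_img lfst (GB k u); rewrite lfstE.
  by have := memv_img lfst (GA k _ _ zG); rewrite !lfstE.
have G0 k x : (x \in lfst @: (G k :&: lker lsnd))%VS = ((x, 0) \in G k).
  apply/memv_imgP/idP => [[[x' y]]|xG].
    by rewrite memv_cap memv_ker lsndE lfstE /= => /andP[xG /eqP y0] ->; rewrite -y0.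
  by exists (x, 0); rewrite ?memv_cap ?memv_ker ?lsndE ?lfstE ?xG /=.
have V0 : forall k, (lfst @: (G k :&: lker lsnd))%VS = 0%VS.
  apply: ao => [k x|k j x]; rewrite !G0 => xG; first by rewrite (GC _ _ xG) linear0.
  by have := GA k _ _ xG; rewrite /= linear0.
move=> k; apply/eqP; rewrite -subv0; apply/subvP => -[x y] zG.
have /eqP x0 : x == 0 by have := memv_img lfst zG; rewrite V0 lfstE -memv0.
move: zG; rewrite memv_cap memv_ker lsndE /= x0 => /andP[_ /eqP->].
exact: mem0v.
Qed.

(** [G k] maps onto [X k] and embeds into [Y k]. *)
Lemma controllable_observable_dim_le k : (\dim {: X k} <= \dim {: Y k})%N.
Proof.
have [G [_ _ _ G1 G2]] := state_graph_dim.
rewrite -(G1 k) (leq_trans _ (dimvS (subvf (lsnd @: G k)%VS))) //.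
by rewrite (limg_dim_eq (G2 k)) -(limg_ker_dim lfst (G k)) leq_addl.
Qed.

(** The dimension bound makes both projections of [G k] bijective; [T] is the second projection
    after the inverse of the first. *)
Lemma similarity : (forall k, \dim {: Y k} <= \dim {: X k})%N ->
  exists (T : forall k, 'Hom(X k, Y k)) (S : forall k, 'Hom(Y k, X k)),
    [/\ node_morphism a b T, forall k x, S k (T k x) = x & forall k y, T k (S k y) = y].
Proof.
move=> dYX; have [G [GB GA GC G1 G2]] := state_graph_dim.
have d1 k : \dim (G k) = \dim {: Y k}.
  apply/eqP; rewrite -(limg_dim_eq (G2 k)) eqn_leq dimvS ?subvf //=.
  rewrite (leq_trans (dYX k)) // -(G1 k) (limg_dim_eq (G2 k)).
  by rewrite -(limg_ker_dim lfst (G k)) leq_addl.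
have G2f k : (lsnd @: G k)%VS = fullv.
  by apply: dim_full_eq; rewrite (limg_dim_eq (G2 k)).
have G1k k : (G k :&: lker lfst)%VS = 0%VS.
  apply/eqP; rewrite -dimv_eq0 -leqn0 -(leq_add2r (\dim (lfst @: G k)%VS)).
  by rewrite limg_ker_dim add0n d1 G1.
pose p k : 'Hom(subvs_of (G k), X k) := (lfst \o linfun vsval)%VF.
pose r k : 'Hom(subvs_of (G k), Y k) := (lsnd \o linfun vsval)%VF.
have pE k g : p k g = (vsval g).1 by rewrite comp_lfunE lfstE lfunE.
have rE k g : r k g = (vsval g).2 by rewrite comp_lfunE lsndE lfunE.
have pK k : cancel (p k) (p k)^-1%VF.
  apply/lker0_lfunK; rewrite -subv0; apply/subvP => g.
  rewrite memv_ker pE memv0 -lfstE -memv_ker => g1.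
  have : vsval g \in (G k :&: lker lfst)%VS by rewrite memv_cap subvsP.
  by rewrite G1k memv0.
have rK k : cancel (r k) (r k)^-1%VF.
  apply/lker0_lfunK; rewrite -subv0; apply/subvP => g.
  rewrite memv_ker rE memv0 -lsndE -memv_ker => g2.
  have : vsval g \in (G k :&: lker lsnd)%VS by rewrite memv_cap subvsP.
  by rewrite G2 memv0.
have pVK k : cancel (p k)^-1%VF (p k).
  move=> x; apply: limg_lfunVK; have : x \in (lfst @: G k)%VS by rewrite G1 memvf.
  case/memv_imgP => z zG ->; have := memv_img (p k) (memvf (vsproj (G k) z)).
  by rewrite pE vsprojK // lfstE.
have rVK k : cancel (r k)^-1%VF (r k).
  move=> x; apply: limg_lfunVK; have : x \in (lsnd @: G k)%VS by rewrite G2f memvf.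
  case/memv_imgP => z zG ->; have := memv_img (r k) (memvf (vsproj (G k) z)).
  by rewrite rE vsprojK // lsndE.
pose T k := (r k \o (p k)^-1)%VF; pose S k := (p k \o (r k)^-1)%VF.
have TE k x : T k x = r k ((p k)^-1%VF x) by exact: comp_lfunE.
have SE k y : S k y = p k ((r k)^-1%VF y) by exact: comp_lfunE.
have TK k : cancel (T k) (S k) by move=> x; rewrite TE SE rK pVK.
have SK k : cancel (S k) (T k) by move=> y; rewrite SE TE pK rVK.
have GT k z : z \in G k -> T k z.1 = z.2.
  move=> zG; rewrite TE -{1}(vsprojK zG) -pE pK rE vsprojK //.
have TG k x : (x, T k x) \in G k.
  have := subvsP ((p k)^-1%VF x); rewrite -{2}(pVK k x) TE pE rE.
  by case: (vsval _).
have Tm : node_morphism a b T.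
  split=> [|k x]; last by rewrite -(GC _ _ (TG k x)).
  split=> [k u|k j x]; first exact: (GT k _ (GB k u)).
  exact: (GT k _ (GA k _ _ (TG j x))).
by exists T, S.
Qed.

End Graph.

End NodeTheory.

(** * Transfer functions are rational *)

Section TransferRational.
Variables (K : fieldType) (N q : nat) (X : 'I_N -> vectType K) (a : GRnode q X).

(** Indexes the bases of all state spaces together; [h u p] below follows coordinate [p] of the
    state reached from input [u]. *)
Let I := {k : 'I_N & 'I_(\dim {: X k})}.
Let e (p : I) : X (tag p) := (vbasis {: X (tag p)})`_(tagged p).
Let crd (p : I) (x : X (tag p)) : K := coord (vbasis {: X (tag p)}) (tagged p) x.
Let h u (p : I) : series K N := fun w => @crd p (state_coef a w (tag p) u).

(** The state left after removing the first letter is expanded in the basis, and the letter series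
    select that first letter. Applied both to state coordinates and to outputs. *)
Lemma rational_state_functional u (f : series K N) (phi : forall k, X k -> K) :
  (forall k, scalar (phi k)) ->
  (forall k w, f (k :: w) = phi k (state_coef a w k u)) ->
  f = series_const (f [::]) +
      \sum_p series_const (phi (tag p) (e p)) * series_letter K (tag p) * h u p.
Proof.
move=> phil fE; apply/funext => w; rewrite seriesDE series_sumE.
case: w => [|k w] /=.
  by rewrite big1 ?addr0 // => p _; rewrite -mulrA series_constM series_letterM mulr0.
pose pk := HB.pack (phi k) (GRing.isLinear.Build K _ _ _ (phi k) (phil k)) : {scalar X k}.
have phiE x : phi k x =
    \sum_l coord (vbasis {: X k}) l x * phi k (vbasis {: X k})`_l.
  rewrite -[phi k]/(pk : _ -> _) {1}(coord_vbasis (memvf x)) linear_sum.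
  by apply: eq_bigr => l _; rewrite linearZ.
rewrite add0r fE phiE.
pose T k' (l : 'I_(\dim {: X k'})) := if k == k' then
  phi k' (vbasis {: X k'})`_l * coord (vbasis {: X k'}) l (state_coef a w k' u) else 0.
transitivity (\sum_(p : I) T (tag p) (tagged p)); last first.
  apply: eq_bigr => p _; rewrite -mulrA series_constM series_letterM /T.
  by case: eqP => _; rewrite ?mulr0.
rewrite -(sig_big_dep predT (fun _ => predT) T) /= (bigD1 k) //=.
rewrite [X in _ + X]big1 => [|k' k'k].
  by rewrite addr0; apply: eq_bigr => l _; rewrite /T eqxx mulrC.
by apply: big1 => l _; rewrite /T eq_sym (negPf k'k).
Qed.

(** The state coordinates solve a linear system whose coefficients are constants times letters,
    hence have no constant term. *)
Lemma rational_state u p : fps_rational (h u p).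
Proof.
pose M (p p' : I) := series_const (@crd p (gr_A a (tag p) (tag p') (e p')))
  * series_letter K (tag p').
have hE p1 : h u p1 = series_const (h u p1 [::]) + \sum_p' M p1 p' * h u p'.
  apply: (@rational_state_functional u (h u p1)
    (fun k x => @crd p1 (gr_A a (tag p1) k x))) => [k c x y|k w].
    by rewrite /crd !linearP.
  by rewrite /h /= comp_lfunE.
rewrite -(enum_rankK p); move: (enum_rank p).
refine (@rational_linear_system K N #|{: I}| (fun i : 'I_#|{: I}| => h u (enum_val i))
  (fun i => series_const (h u (enum_val i) [::]))
  (fun i j => M (enum_val i) (enum_val j)) _ _ _ _) => [i|i j|i j|i].
- exact: rational_const.
- exact/rational_mul/rational_letter/rational_const.
- exact: etrans (series_constM _ _ _) (mulr0 _).
- by rewrite {1}hE (reindex _ (onW_bij _ (@enum_val_bij I))).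
Qed.

Lemma transfer_rational : mx_fps_rational (transfer a).
Proof.
move=> r c; pose u : 'cV[K]_q := delta_mx c 0.
pose f : series K N := fun w => transfer a w r c.
have fE w : f w = (transfer a w *m u) r 0 by rewrite -colE mxE.
rewrite -/f (@rational_state_functional u f (fun k x => gr_C a k x r 0)).
- apply: rational_add; first exact: rational_const.
  apply: rational_sum => p; apply: rational_mul; last exact: rational_state.
  exact/rational_mul/rational_letter/rational_const.
- by move=> k d x y; rewrite linearP !mxE.
- by move=> k w; rewrite fE transfer_cons.
Qed.

End TransferRational.

(** * Products and minimal realizations *)

Section Products.
Variables (K : fieldType) (N q : nat).
Implicit Types X Y : 'I_N -> vectType K.

(** The last letter acts first: [a2] processes a suffix, and its output drives [a1] along the
    remaining prefix. *)
Lemma state_coef_mul X1 X2 (a1 : GRnode q X1) (a2 : GRnode q X2) w j u :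
  state_coef (gr_mul a1 a2) w j u =
  (\sum_(i < (size w).+1) state_coef a1 (take i w) j (transfer a2 (drop i w) *m u),
   state_coef a2 w j u).
Proof.
elim: w j => [|k w IHw] j.
  by rewrite big_ord1 [LHS]gr_mul_BE /= transfer_nil.
rewrite [LHS]comp_lfunE IHw gr_mul_AE /= comp_lfunE; congr pair.
rewrite (sum_split_cons (fun s t => state_coef a1 s j (transfer a2 t *m u))).
rewrite transfer_cons addrC linear_sum; congr (_ + _); apply: eq_bigr => i _.
by rewrite /= comp_lfunE.
Qed.

Lemma transfer_mul X1 X2 (a1 : GRnode q X1) (a2 : GRnode q X2) :
  transfer (gr_mul a1 a2) =1 fps_mul (transfer a1) (transfer a2).
Proof.
case=> [|j w]; apply: mulmx_cV_ext => u.
  by rewrite fps_mul_nil -mulmxA !transfer_nil /= comp_lfunE.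
rewrite fps_mul_cons mulmxDl -mulmxA transfer_nil !transfer_cons.
rewrite state_coef_mul gr_mul_CE /= addrC; congr (_ + _).
rewrite linear_sum /fps_mul mulmx_suml; apply: eq_bigr => i _.
by rewrite -mulmxA transfer_cons.
Qed.

Lemma morphism_mul X1 X2 Y1 Y2 (a1 : GRnode q X1) (a2 : GRnode q X2)
    (b1 : GRnode q Y1) (b2 : GRnode q Y2) T1 T2 :
  gr_D a1 = gr_D b1 -> gr_D a2 = gr_D b2 ->
  node_morphism a1 b1 T1 -> node_morphism a2 b2 T2 ->
  node_morphism (gr_mul a1 a2) (gr_mul b1 b2) (fun k => lpair (T1 k) (T2 k)).
Proof.
move=> D1 D2 [[TB1 TA1] TC1] [[TB2 TA2] TC2].
split=> [|k x]; last by rewrite lpairE !gr_mul_CE /= TC1 TC2 D1.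
split=> [k u|k j x]; first by rewrite lpairE !gr_mul_BE /= TB1 TB2 D2.
by rewrite !lpairE !gr_mul_AE /= linearD /= TA1 TB1 TA2 TC2.
Qed.

Lemma morphism_comp X Y Z (a : GRnode q X) (b : GRnode q Y) (c : GRnode q Z) T S :
  node_morphism a b T -> node_morphism b c S ->
  node_morphism a c (fun k => S k \o T k)%VF.
Proof.
move=> [[TB TA] TC] [[SB SA] SC].
split=> [|k x]; last by rewrite comp_lfunE SC TC.
by split=> [k u|k j x]; rewrite !comp_lfunE ?TB ?SB ?TA ?SA.
Qed.

End Products.

(** * Existence and properties of minimal realizations *)

Section Minimality.
Variables (K : fieldType) (N q : nat).
Implicit Types X Y : 'I_N -> vectType K.
Variable F : fps 'M[K]_q N.
Hypothesis F1 : F [::] = 1%:M.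

Lemma minimal_controllable_observable X (a : GRnode q X) :
  minimal_realization a F -> controllable a /\ observable a.
Proof.
move=> [aF amin]; have aD := realization_D1 F1 aF.
have atot Y (b : GRnode q Y) : transfer b =1 transfer a -> (total_dim X <= total_dim Y)%N.
  by move=> ba; apply: leq_sum => k _; apply: (amin Y b) => w; rewrite ba aF.
by split; [exact: smallest_controllable | exact: smallest_observable].
Qed.

(** All state spaces are copies of the state space of a linear representation; [gr_A a k j] is [M j]
    for every [k], so the state after [w] is [h w] applied to the input. *)
Lemma rational_realization : mx_fps_rational F ->
  exists X (a : GRnode q X), gr_realization a F.
Proof.
move=> /mx_rational_recognizable[n [M [h [c [hE FE]]]]].
pose X (k : 'I_N) : vectType K := 'cV[K]_n.
pose a : GRnode q X := @GRNode K N q X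
  (fun k j => linfun (mulmx (M j) : 'cV_n -> 'cV_n))
  (fun k => linfun (mulmx (h [::]) : 'cV_q -> 'cV_n))
  (fun j => linfun (mulmx (c *m M j) : 'cV_n -> 'cV_q)) \1%VF.
have stE w j u : state_coef a w j u = h w *m u.
  elim: w j => [|k w IHw] j; first by rewrite /= lfunE.
  by rewrite [LHS]comp_lfunE IHw lfunE /= hE mulmxA.
exists X, a; case=> [|j w]; apply: mulmx_cV_ext => u.
  by rewrite transfer_nil id_lfunE F1 mul1mx.
by rewrite transfer_cons stE lfunE /= FE hE !mulmxA.
Qed.

(** Minimality asks for every dimension to be least simultaneously. A realization of least total
    dimension achieves this, being controllable and observable. *)
Lemma minimal_realization_exists : mx_fps_rational F ->
  exists X (a : GRnode q X), minimal_realization a F.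
Proof.
move=> /rational_realization[X0 [a0 a0F]].
pose P n := `[< exists X (a : GRnode q X), gr_realization a F /\ total_dim X = n >].
have exP : exists n, P n by exists (total_dim X0); apply/asboolP; exists X0, a0.
case: (ex_minnP exP) => n /asboolP[X [a [aF dX]]] minX.
have aD := realization_D1 F1 aF.
have atot Y (b : GRnode q Y) : transfer b =1 transfer a -> (total_dim X <= total_dim Y)%N.
  move=> ba; rewrite dX; apply/minX/asboolP; exists Y, b; split=> // w.
  by rewrite ba aF.
exists X, a; split=> // Y b bF; apply: (@controllable_observable_dim_le _ _ _ X Y a b).
- by move=> w; rewrite aF bF.
- exact: smallest_controllable.
- exact: smallest_observable.
Qed.

End Minimality.

(** * Supporting projections *)

Section Supporting.
Variables (K : fieldType) (N q : nat) (X : 'I_N -> vectType K) (a : GRnode q X).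
Hypothesis aD : gr_D a = \1%VF.

Lemma Across1E k j x : gr_Across a k j x = gr_A a k j x - gr_B a k (gr_C a j x).
Proof.
rewrite /gr_Across aD add_lfunE opp_lfunE !comp_lfunE; congr (_ - gr_B a k _).
(* The inverse of the identity acts as the identity, since every vector lies in its range. *)
rewrite -[LHS]id_lfunE.
by rewrite limg_lfunVK // -[X in X \in _]id_lfunE memv_img ?memvf.
Qed.

Section Projection.
Variable P : forall k, 'End(X k).
Hypothesis Psup : supporting_projection a P.

Lemma supporting_idem k x : P k (P k x) = P k x.
Proof. by case: Psup => PP _ _; rewrite -comp_lfunE PP. Qed.

Lemma mem_limg_supporting k x : (x \in limg (P k)) = (P k x == x).
Proof.
apply/idP/eqP => [/memv_imgP[y _ ->]|<-]; first exact: supporting_idem.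
exact/memv_img/memvf.
Qed.

Lemma dim_supporting k : (\dim (lker (P k)) + \dim (limg (P k)))%N = \dim {: X k}.
Proof. by rewrite -[RHS](limg_ker_dim (P k)) capfv. Qed.

Definition ker_ran_sum k :
    'Hom((subvs_of (lker (P k)) * subvs_of (limg (P k)))%type, X k) :=
  ((linfun vsval \o lfst) + (linfun vsval \o lsnd))%VF.

Lemma ker_ran_sumE k z : ker_ran_sum k z = vsval z.1 + vsval z.2.
Proof. by rewrite add_lfunE !comp_lfunE lfstE lsndE !lfunE. Qed.

(** Invariance of the kernels under [gr_A] makes the lower left block vanish; invariance of the
    ranges under [gr_Across] identifies the upper right block with input of the first factor after
    output of the second. *)
Lemma supporting_morphism :
  node_morphism (gr_mul (pr_ker a P) (pr_ran a P)) a ker_ran_sum.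
Proof.
have [_ PA PAx] := Psup.
have QE k x : (\1 - P k)%VF x = x - P k x by rewrite add_lfunE opp_lfunE id_lfunE.
have vQ k x : vsval (vsproj (lker (P k)) (x - P k x)) = x - P k x.
  by apply: vsprojK; rewrite memv_ker linearB /= supporting_idem subrr.
have vP k x : vsval (vsproj (limg (P k)) (P k x)) = P k x.
  by apply: vsprojK; rewrite memv_img ?memvf.
split=> [|k z]; last first.
  rewrite ker_ran_sumE gr_mul_CE !compress_CE linearD; congr (_ + _).
  by rewrite /= id_lfunE.
have sumE k x y : ker_ran_sum k (x, y) = vsval x + vsval y by exact: ker_ran_sumE.
have vD k (x y : subvs_of (lker (P k))) : vsval (x + y) = vsval x + vsval y.
  exact: linearD.
split=> [k u|k j z].
  by rewrite gr_mul_BE sumE !compress_BE QE vQ vP id_lfunE subrK.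
rewrite gr_mul_AE sumE vD compress_BE compress_CE.
rewrite !compress_AE !QE !vQ vP.
rewrite ker_ran_sumE linearD; set s := vsval z.1; set t := vsval z.2.
have -> : P k (gr_A a k j s) = 0.
  by apply/eqP; rewrite -memv_ker (subvP (PA k j)) // memv_img ?subvsP.
(* For [t] in the range this yields A t = P A t + (I - P) B C t. *)
have : P k (gr_Across a k j t) = gr_Across a k j t.
  by apply/eqP; rewrite -mem_limg_supporting (subvP (PAx k j)) // memv_img ?subvsP.
rewrite Across1E linearB subr0 => /eqP; rewrite eq_sym subr_eq => /eqP tE.
by rewrite -addrA; congr (_ + _); rewrite [RHS]tE addrC addrA addrAC.
Qed.

Lemma supporting_transfer :
  transfer a =1 fps_mul (transfer (pr_ker a P)) (transfer (pr_ran a P)).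
Proof.
move=> w; rewrite -transfer_mul; apply/esym.
apply: (morphism_transfer _ supporting_morphism).
by rewrite aD /= comp_lfun1l.
Qed.

Lemma supporting_minimal_factorization (F : fps 'M[K]_q N) : minimal_realization a F ->
  minimal_factorization F (transfer (pr_ker a P)) (transfer (pr_ran a P)).
Proof.
move=> [aF amin]; have FE : F =1 fps_mul (transfer (pr_ker a P)) (transfer (pr_ran a P)).
  by move=> w; rewrite -aF supporting_transfer.
split=> //; [exact: transfer_rational | exact: transfer_rational |].
move=> X1 X2 a1 a2 [a1F m1] [a2F m2]; split=> [w|Y b bF k].
  by rewrite transfer_mul FE; congr fps_mul; apply/funext.
(* The compressions realize the two factors, so they bound the dimensions of [X1 k] and [X2 k]. *)
rewrite (leq_trans _ (amin Y b bF k)) // -dim_supporting.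
rewrite dimvf /dim /= leq_add //.
  by have := m1 _ (pr_ker a P) (frefl _) k; rewrite dim_subvsf dimvf.
by have := m2 _ (pr_ran a P) (frefl _) k; rewrite dim_subvsf dimvf.
Qed.

End Projection.
End Supporting.

(** * From minimal factorizations to supporting projections *)

Section FactorizationProjection.
Variables (K : fieldType) (N q : nat) (X : 'I_N -> vectType K) (a : GRnode q X).
Variables (X1 X2 : 'I_N -> vectType K) (a1 : GRnode q X1) (a2 : GRnode q X2).
Hypotheses (aD : gr_D a = \1%VF) (aD1 : gr_D a1 = \1%VF) (aD2 : gr_D a2 = \1%VF).

Section Similarity.
Variables (T : forall k, 'Hom((X1 k * X2 k)%type, X k))
          (S : forall k, 'Hom(X k, (X1 k * X2 k)%type)).
Hypothesis Tm : node_morphism (gr_mul a1 a2) a T.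
Hypotheses (TK : forall k z, S k (T k z) = z) (SK : forall k x, T k (S k x) = x).

Definition factor_projection k : 'End(X k) := (T k \o (linr \o (lsnd \o S k)))%VF.

Lemma factor_projectionE k x : factor_projection k x = T k (0, (S k x).2).
Proof. by rewrite !comp_lfunE lsndE linrE. Qed.

Lemma factor_projectionT k z : factor_projection k (T k z) = T k (0, z.2).
Proof. by rewrite factor_projectionE TK. Qed.

Lemma factor_projectionC k z :
  (\1 - factor_projection k)%VF (T k z) = T k (z.1, 0).
Proof.
rewrite add_lfunE opp_lfunE id_lfunE factor_projectionT -linearB.
by congr (T k _); case: z => x y; congr pair; rewrite /= ?subr0 ?subrr.
Qed.

Lemma factor_projection_idem k x :
  factor_projection k (factor_projection k x) = factor_projection k x.
Proof. by rewrite [factor_projection k x]factor_projectionE factor_projectionT. Qed.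

Lemma mem_lker_factor k z : (T k z \in lker (factor_projection k)) = (z.2 == 0).
Proof.
rewrite memv_ker factor_projectionT; apply/eqP/eqP => [T0|->]; last exact: linear0.
by have := congr1 (fun x => (S k x).2) T0; rewrite /= TK linear0.
Qed.

Lemma mem_limg_factor k z : (T k z \in limg (factor_projection k)) = (z.1 == 0).
Proof.
apply/memv_imgP/eqP => [[x _]|z0].
  by rewrite factor_projectionE => /(congr1 (fun x => (S k x).1)); rewrite /= !TK.
exists (T k z); first exact: memvf.
by rewrite factor_projectionT -z0 -surjective_pairing.
Qed.

(** In the product node, A is block upper triangular, while A - BC is block lower triangular: with
    both D equal to the identity, its upper right block is B'C'' - B'C'' = 0. *)
Lemma factor_projection_supporting : supporting_projection a factor_projection.
Proof.
case: Tm => -[TB TA] TC; split=> [k|k j|k j].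
- by apply/lfunP => x; rewrite comp_lfunE factor_projection_idem.
- apply/subvP => _ /memv_imgP[x + ->].
  rewrite -(SK x) mem_lker_factor -TA mem_lker_factor gr_mul_AE /= => /eqP->.
  by rewrite linear0.
apply/subvP => _ /memv_imgP[x + ->].
rewrite -(SK x) mem_limg_factor Across1E // TC -TA -TB -linearB mem_limg_factor.
rewrite gr_mul_AE gr_mul_BE gr_mul_CE aD1 aD2 !id_lfunE => /eqP /= ->.
by rewrite !linear0 !add0r subrr.
Qed.

(** The map sending [x] to [T k (x, 0)] is a morphism from [a1] to the compression. *)
Lemma transfer_factor_ker : transfer (pr_ker a factor_projection) =1 transfer a1.
Proof.
case: Tm => -[TB TA] TC.
pose T1 k := (linfun (vsproj (lker (factor_projection k))) \o (T k \o linl))%VF.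
have T1E k x : T1 k x = vsproj _ (T k (x, 0)) by rewrite !comp_lfunE linlE lfunE.
have vT1 k x : vsval (T1 k x) = T k (x, 0).
  by rewrite T1E vsprojK // mem_lker_factor.
move=> w; apply/esym; apply: (@morphism_transfer _ _ _ _ _ a1 _ T1); first by rewrite aD1.
split=> [|k x]; last first.
  by rewrite compress_CE vT1 TC gr_mul_CE /= !linear0 addr0.
split=> [k u|k j x].
  rewrite T1E compress_BE -TB factor_projectionC gr_mul_BE aD2 id_lfunE //.
rewrite T1E compress_AE vT1 -TA factor_projectionC gr_mul_AE /=.
by rewrite !linear0 addr0.
Qed.

Lemma transfer_factor_ran : transfer (pr_ran a factor_projection) =1 transfer a2.
Proof.
case: Tm => -[TB TA] TC.
pose T2 k := (linfun (vsproj (limg (factor_projection k))) \o (T k \o linr))%VF.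
have T2E k y : T2 k y = vsproj _ (T k (0, y)) by rewrite !comp_lfunE linrE lfunE.
have vT2 k y : vsval (T2 k y) = T k (0, y).
  by rewrite T2E vsprojK // mem_limg_factor.
move=> w; apply/esym; apply: (@morphism_transfer _ _ _ _ _ a2 _ T2); first by rewrite aD2.
split=> [|k y]; last first.
  by rewrite compress_CE vT2 TC gr_mul_CE /= aD1 id_lfunE linear0 add0r.
split=> [k u|k j y].
  by rewrite T2E compress_BE -TB factor_projectionT gr_mul_BE.
by rewrite T2E compress_AE vT2 -TA factor_projectionT gr_mul_AE.
Qed.

End Similarity.

(** Serves uniqueness: [a1] and [a2] are similar to the two compressions, and adding the components
    in kernel and range carries the projection onto the second factor to [P]. *)
Lemma supporting_projection_similar P :
  supporting_projection a P ->
  transfer a1 =1 transfer (pr_ker a P) -> transfer a2 =1 transfer (pr_ran a P) ->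
  controllable a1 -> observable a1 -> controllable a2 -> observable a2 ->
  (forall k, \dim {: X k} <= \dim {: X1 k} + \dim {: X2 k})%N ->
  exists T, node_morphism (gr_mul a1 a2) a T /\
    (forall k z, P k (T k z) = T k (0, z.2)).
Proof.
move=> Psup t1 t2 c1 o1 c2 o2 dX.
have d1 k := controllable_observable_dim_le t1 c1 o1 k.
have d2 k := controllable_observable_dim_le t2 c2 o2 k.
have dE k : (\dim (lker (P k)) + \dim (limg (P k)) <= \dim {: X1 k} + \dim {: X2 k})%N.
  by rewrite dim_supporting.
(* Since [X2 k] is no larger than the range, the bound [dE] forces the kernel to be no larger than
   [X1 k]; symmetrically for the range. *)
have [|T1 [_ [T1m _ _]]] := similarity t1 c1 o1.
  move=> k; rewrite dim_subvsf -(leq_add2r (\dim (limg (P k)))).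
  by rewrite (leq_trans (dE k)) // leq_add2l; have := d2 k; rewrite dim_subvsf.
have [|T2 [_ [T2m _ _]]] := similarity t2 c2 o2.
  move=> k; rewrite dim_subvsf -(leq_add2l (\dim (lker (P k)))).
  by rewrite (leq_trans (dE k)) // leq_add2r; have := d1 k; rewrite dim_subvsf.
have Tm := morphism_comp
  (morphism_mul (b1 := pr_ker a P) (b2 := pr_ran a P) aD1 aD2 T1m T2m)
  (supporting_morphism aD Psup).
eexists; split=> [|k z]; first exact: Tm.
rewrite !comp_lfunE !ker_ran_sumE !lpairE /= linear0.
have /eqP P1 : P k (vsval (T1 k z.1)) == 0 by rewrite -memv_ker subvsP.
have /eqP P2 : P k (vsval (T2 k z.2)) == vsval (T2 k z.2).
  by rewrite -(mem_limg_supporting Psup) subvsP.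
rewrite linearD /= P1 P2; congr (_ + _); exact/esym/linear0.
Qed.

End FactorizationProjection.

Lemma minimal_factorization_projection (K : fieldType) (N q : nat)
    (X : 'I_N -> vectType K) (a : GRnode q X) (F F1 F2 : fps 'M[K]_q N) :
  F [::] = 1%:M -> F1 [::] = 1%:M -> F2 [::] = 1%:M ->
  minimal_realization a F -> minimal_factorization F F1 F2 ->
  exists! P : forall k, 'End(X k),
    [/\ supporting_projection a P, transfer (pr_ker a P) =1 F1 &
        transfer (pr_ran a P) =1 F2].
Proof.
move=> F0 F10 F20 amin [/(minimal_realization_exists F10)[X1 [a1 a1min]]].
move=> /(minimal_realization_exists F20)[X2 [a2 a2min]] FE Fmin.
have mmin := Fmin _ _ _ _ a1min a2min.
have [a1c a1o] := minimal_controllable_observable F10 a1min.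
have [a2c a2o] := minimal_controllable_observable F20 a2min.
have [mc mo] := minimal_controllable_observable F0 mmin.
have [[aF adim] [a1F _] [a2F _] [mF mdim]] := And4 amin a1min a2min mmin.
have aD := realization_D1 F0 aF.
have aD1 := realization_D1 F10 a1F.
have aD2 := realization_D1 F20 a2F.
have ma : transfer (gr_mul a1 a2) =1 transfer a by move=> w; rewrite mF aF.
(* The dimension bound for the similarity is minimality of [a] compared with the product node. *)
have [|T [S [Tm TK SK]]] := similarity ma mc mo; first exact: (adim _ _ mF).
exists (factor_projection T S); split.
  split; first exact: (factor_projection_supporting aD aD1 aD2 Tm TK SK).
    by move=> w; rewrite (transfer_factor_ker aD1 aD2 Tm TK).
  by move=> w; rewrite (transfer_factor_ran aD1 aD2 Tm TK).
move=> P [Psup PF1 PF2].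
have [||k|T' [T'm PT']] :=
  supporting_projection_similar aD aD1 aD2 Psup _ _ a1c a1o a2c a2o.
- by move=> w; rewrite PF1.
- by move=> w; rewrite PF2.
- by have := adim _ _ mF k; rewrite [in X in (_ <= X)%N -> _]dimvf /dim /= -!dimvf.
(* Both are morphisms out of the controllable product node, so [P] and the constructed projection
   agree on every [T k z], hence everywhere. *)
have TT' k z : T' k z = T k z by apply: (intertwines_unique mc (proj1 T'm) (proj1 Tm)).
apply/functional_extensionality_dep => k; apply/lfunP => x.
by rewrite -(SK k x) factor_projectionT // -!TT' PT'.
Qed.

Theorem theorem3p11 (R : realType) (N q : nat) (F : fps 'M[R[i]]_q N)
    (gam : 'I_N -> nat)
    (a : GRnode q (fun k : 'I_N => 'cV[R[i]]_(gam k) : vectType R[i])) :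
  mx_fps_rational F ->
  F [::] = 1%:M ->
  gr_D a = \1%VF ->
  minimal_realization a F ->
  (forall P : forall k : 'I_N, 'End('cV[R[i]]_(gam k)),
     supporting_projection a P ->
     minimal_factorization F (transfer (pr_ker a P)) (transfer (pr_ran a P))) /\
  (forall F1 F2 : fps 'M[R[i]]_q N,
     F1 [::] = 1%:M -> F2 [::] = 1%:M ->
     minimal_factorization F F1 F2 ->
     exists! P : forall k : 'I_N, 'End('cV[R[i]]_(gam k)),
       [/\ supporting_projection a P,
           transfer (pr_ker a P) =1 F1 &
           transfer (pr_ran a P) =1 F2]).
Proof.
move=> _ F0 aD amin; split=> [P Psup|F1 F2 F10 F20 Fmin].
  exact: (supporting_minimal_factorization aD Psup amin).
exact: (minimal_factorization_projection F0 F10 F20 amin Fmin).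
Qed.
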